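(* Let $(p,l_1)\in\Psi_1^{\rm irr}$. If $\Delta_{(p,l_1)}\neq 0$, then for each $n>1$ there exists exactly one irregular pair of order $n$ related to $(p,l_1)$. Thus there is a unique sequence $(l_n)_{n\ge 1}$ (starting with the given $l_1$), resp. a unique sequence $(s_n)_{n\geq 1}$ (with $s_1=l_1$), such that for all $n\ge1$ $$(p,l_n)\in\Psi_n^{\rm irr}\quad\text{resp.}\quad (p,s_1,\ldots,s_n)\in\widehat{\Psi}_n^{\rm irr},$$ where for $n>1$ the pair of order $n$ is related to $(p,l_1)$, and one has $$l_1\le l_2\le l_3\le\cdots,\qquad \lim_{n\to\infty}l_n=\infty .$$ Moreover $$\Delta_{(p,l_1)}=\Delta_{(p,l_2)}=\Delta_{(p,l_3)}=\cdots .$$ If $p$ is an irregular prime with $\Delta(p)=1$, then $i(p)=i_2(p)=i_3(p)=\cdots$.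
   Context: $B_n$ denotes the Bernoulli numbers, $\frac{z}{e^z-1}=\sum_{n\ge0}B_n\frac{z^n}{n!}$, and $\widehat{B}(n)=B_n/n$. $\varphi$ is Euler's totient function. For a rational $q$ and a positive integer $m$, $m\mid q$ (also written $q\equiv0\pmod m$) means that $m$ divides the numerator of $q$ in lowest terms. Congruences modulo powers of $p$ are between $p$-integral rationals. $p$ always denotes an odd prime. For $n\ge1$, $\Psi_n^{\rm irr}$ is the set of irregular pairs of order $n$: pairs $(p,l)$ with $p$ an odd prime, $l$ even, $2\le l<\varphi(p^n)$ and $p^n\mid\widehat{B}(l)$. Put $i_n(p)=\#\{(p,l)\in\Psi_n^{\rm irr}\}$ and $i(p)=i_1(p)$; $p$ is irregular if $i(p)>0$. For $n>m\ge1$, $(p,l_n)\in\Psi_n^{\rm irr}$ is related to $(p,l_m)\in\Psi_m^{\rm irr}$ if $l_n\equiv l_m\pmod{\varphi(p^m)}$. For $(p,l)\in\Psi_n^{\rm irr}$ (regarded as a pair of order $n$), $\Delta_{(p,l)}$ is the integer with $0\le\Delta_{(p,l)}<p$ and $\Delta_{(p,l)}\equiv p^{-n}\left(\widehat{B}(l+\varphi(p^n))-\widehat{B}(l)\right)\pmod p$. In the chain of equalities, $\Delta_{(p,l_n)}$ is computed with $(p,l_n)$ regarded as a pair of order $n$. For an irregular prime $p$, $\Delta(p)=1$ if $\Delta_{(p,l)}\ne0$ for all $(p,l)\in\Psi_1^{\rm irr}$, and $\Delta(p)=0$ otherwise. $p$-adic notation: $\widehat{\Psi}_n^{\rm irr}$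 is the set of tuples $(p,s_1,\ldots,s_n)$ with $0\le s_\nu<p$, $s_1$ even, $2\le s_1\le p-3$, such that $(p,l)\in\Psi_n^{\rm irr}$ for $l=\sum_{\nu=1}^n s_\nu\,\varphi(p^{\nu-1})$. The tuple is called related to $(p,l_1)$ if the pair $(p,l)$ is. *)

(* Defs.v *)
From mathcomp Require Import all_boot all_order all_algebra.
Set Implicit Arguments.
Unset Strict Implicit.
Unset Printing Implicit Defensive.
Import Order.TTheory GRing.Theory Num.Theory.

Local Open Scope ring_scope.

(* The coefficients b_0, ..., b_(n-1) of the formal power series z/(e^z - 1),
   obtained by inverting (e^z - 1)/z = \sum_j z^j/(j+1)!. *)
Fixpoint bernoulli_egf (n : nat) : seq rat :=
  if n is m.+1 then
    let b := bernoulli_egf m in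
    rcons b ((m == 0)%N%:R - \sum_(k < m) b`_k / ((m - k).+1)`!%:R)
  else [::].

Definition bernoulli (n : nat) : rat := n`!%:R * (bernoulli_egf n.+1)`_n.

Lemma size_bernoulli_egf n : size (bernoulli_egf n) = n.
Proof. by elim: n => //= n IHn; rewrite size_rcons IHn. Qed.

Lemma nth_bernoulli_egf m n :
  (m < n)%N -> (bernoulli_egf n)`_m = (bernoulli_egf m.+1)`_m.
Proof.
elim: n => // n IHn; rewrite ltnS leq_eqVlt => /predU1P[-> //|lt_mn].
by rewrite [LHS]/= nth_rcons size_bernoulli_egf lt_mn IHn.
Qed.

(* The identity (\sum_k B_k z^k/k!) * ((e^z - 1)/z) = 1, coefficientwise. *)
Lemma bernoulliP n :
  \sum_(k < n.+1) bernoulli k / k`!%:R * ((n - k).+1`!%:R)^-1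
    = (n == 0)%N%:R.
Proof.
have fact_neq0 k : k`!%:R != 0 :> rat by rewrite pnatr_eq0 -lt0n fact_gt0.
have bE k : bernoulli k / k`!%:R = (bernoulli_egf k.+1)`_k.
  by rewrite /bernoulli mulrC mulKf.
rewrite big_ord_recr /= subnn divr1 bE [X in _ + X]/= nth_rcons.
rewrite size_bernoulli_egf ltnn eqxx addrC -addrA -[RHS]addr0; congr (_ + _).
apply/eqP; rewrite addrC subr_eq0; apply/eqP/eq_bigr => k _.
by rewrite bE (nth_bernoulli_egf (ltn_ord k)).
Qed.

Definition Bhat (n : nat) : rat := bernoulli n / n%:R.

Definition dvdq (m : nat) (q : rat) : bool := (m%:Z %| numq q)%Z.

Definition pintegral (p : nat) (q : rat) : bool := ~~ (p%:Z %| denq q)%Z.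

(* a = b modulo p ^ r, for p-integral rationals a and b. *)
Definition eqq_mod (p r : nat) (a b : rat) : bool :=
  [&& pintegral p a, pintegral p b & dvdq (p ^ r) (a - b)].

Local Open Scope nat_scope.

Definition Psi_irr (n : nat) : {pred nat * nat} :=
  [pred x | [&& prime x.1, odd x.1, ~~ odd x.2, 2 <= x.2,
                x.2 < totient (x.1 ^ n) & dvdq (x.1 ^ n) (Bhat x.2)]].

Definition i_ (n p : nat) : nat :=
  #|[set l : 'I_(totient (p ^ n)) | (p, val l) \in Psi_irr n]|.

Definition irregular (p : nat) : bool := [&& prime p, odd p & 0 < i_ 1 p].

(* (p, ln), of order n > m, is related to (p, lm), of order m. *)
Definition related (p m ln lm : nat) : bool :=
  ln == lm %[mod totient (p ^ m)].

(* The value 0 when no residue satisfies the congruence is a mere default: for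
   (p, l) in Psi_irr n the Kummer congruences provide one. *)
Definition Delta (n p l : nat) : nat :=
  oapp val 0
    [pick d : 'I_p | eqq_mod p 1 (d%:R)%R
       ((p ^ n)%:R^-1 * (Bhat (l + totient (p ^ n)) - Bhat l))%R].

Definition Delta_prime (p : nat) : nat :=
  [forall l : 'I_(totient (p ^ 1)),
     ((p, val l) \in Psi_irr 1) ==> (Delta 1 p l != 0)].

(* Tuples are indexed from 0: the digit s_(v+1) is s`_v. *)
Definition padic_index (p n : nat) (s : n.-tuple nat) : nat :=
  \sum_(v < n) tnth s v * totient (p ^ v).

Definition Psihat_irr (n p : nat) (s : n.-tuple nat) : bool :=
  [&& all (fun d => d < p) s, ~~ odd (head 0 s), 2 <= head 0 s <= p - 3
    & (p, padic_index p s) \in Psi_irr n].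

(* Sequences are functions on nat whose value at 0 is irrelevant. *)
Definition irr_sequence (p l1 : nat) (l : nat -> nat) : Prop :=
  [/\ l 1 = l1,
      forall n, 1 <= n -> (p, l n) \in Psi_irr n
    & forall n, 1 < n -> related p 1 (l n) l1].

Definition digits (s : nat -> nat) (n : nat) : n.-tuple nat :=
  [tuple s v.+1 | v < n].

Definition irr_digit_sequence (p l1 : nat) (s : nat -> nat) : Prop :=
  [/\ s 1 = l1,
      forall n, 1 <= n -> Psihat_irr p (digits s n)
    & forall n, 1 < n -> related p 1 (padic_index p (digits s n)) l1].

(* Main.v *)
(* For a prime to p, Voronoi's congruence presents (a^l - 1)(1 - p^(l-1)) B_l / l,
   modulo any power of p, as a finite sum of terms c r^(l-1) with c, r integers and
   r prime to p.  Writing r^(p-1) = 1 + p q, such sums are affine in the following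
   sense: on l = l1 + (p-1) x they define a function f with
     f (x + p^n t) = f x + t p^(n+1) D  mod p^(n+2)
   where D mod p depends only on l1 (and a).  Choosing a with a^l1 - 1 prime to p,
   which is possible as p - 1 does not divide l1, one finds that Delta_(p,l) is
   D / (a^l1 - 1) mod p for every irregular pair (p,l) of any order above (p,l1); so
   all the Delta agree, and if D is prime to p then the zero of f modulo p lifts
   uniquely, one digit of x at a time.  That l_n tends to infinity requires B_l <> 0
   for l even, which holds since 3 divides its denominator (von Staudt). *)
Require Import Defs.
From HB Require Import structures.
From mathcomp Require Import all_boot all_order all_algebra.
From mathcomp Require Import fingroup cyclic.
From mathcomp Require Import ring zify.
Set Implicit Arguments.
Unset Strict Implicit.
Unset Printing Implicit Defensive.
Import Order.TTheory GRing.Theory Num.Theory.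

(** * Power sums *)

Section Bernoulli.
Local Open Scope ring_scope.

Lemma fact_neq0 n : n`!%:R != 0 :> rat.
Proof. by rewrite pnatr_eq0 -lt0n fact_gt0. Qed.

Lemma bin_ratE n k : (k <= n)%N ->
  'C(n, k)%:R = n`!%:R / k`!%:R / (n - k)`!%:R :> rat.
Proof.
move=> kn; have /(congr1 (fun n => n%:R : rat)) := bin_fact kn.
by rewrite !natrM => <-; field; rewrite !fact_neq0.
Qed.

(** Induction on [N]: in the increment of the right-hand side, the coefficient of N^i/i! is the
    Cauchy product of [bernoulliP] at m - i, which is 1 for i = m and 0 below. *)
Lemma faulhaber_egf m N :
  \sum_(j < N) (j ^ m)%:R / m`!%:R
  = \sum_(k < m.+1) bernoulli (m - k) / (m - k)`!%:R * (N ^ k.+1)%:R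
      / (k.+1)`!%:R.
Proof.
elim: N => [|N IHN].
  rewrite big_ord0 big1 // => k _.
  by rewrite exp0n // mulr0 mul0r.
rewrite big_ord_recr /= {}IHN.
apply/eqP; rewrite eq_sym addrC -subr_eq -sumrB; apply/eqP.
transitivity (\sum_(k < m.+1) \sum_(i < m.+1 | (i <= k)%N)
   bernoulli (m - k) / (m - k)`!%:R / (k - i).+1`!%:R * ((N ^ i)%:R / i`!%:R)).
  apply: eq_bigr => k _.
  rewrite -mulrBl -mulrBr -[N.+1]add1n expnDn big_ord_recr /= subnn expn0 mul1n.
  rewrite binn mul1n natrD addrK natr_sum mulr_sumr mulr_suml.
  pose F (i : nat) : rat := bernoulli (m - k) / (m - k)`!%:R
    * ('C(k.+1, i) * (1 ^ (k.+1 - i) * N ^ i))%:R / k.+1`!%:R.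
  rewrite (eq_bigr (F \o val)) // (big_ord_widen m.+1 F) ?ltn_ord //.
  apply: eq_bigr => i /[1!ltnS] ik.
  rewrite /F exp1n mul1n natrM bin_ratE 1?ltnW // subSn //.
  by field; rewrite !fact_neq0.
rewrite (exchange_big_dep xpredT) //= (bigD1 ord_max) //=.
rewrite [X in _ + X]big1 ?addr0 => [|i /negPf nim]; rewrite -mulr_suml.
  rewrite (bigD1 ord_max) //= big1 ?addr0 => [|i /andP[mi /eqP[]]]; last first.
    by apply: val_inj; apply/eqP; rewrite eqn_leq mi -ltnS ltn_ord.
  rewrite subnn; have := bernoulliP 0; rewrite big_ord1 /= subn0 => ->.
  by rewrite mul1r.
rewrite (reindex_inj rev_ord_inj) /=.
have := bernoulliP (m - i).
pose F (k : nat) : rat := bernoulli k / k`!%:R / (m - i - k).+1`!%:R.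
rewrite (eq_bigr (F \o val)) // (big_ord_widen m.+1 F) ?ltnS ?leq_subr //.
rewrite subn_eq0 leqNgt ltn_neqAle -ltnS ltn_ord andbT.
rewrite (_ : (_ == _ :> nat) = false) // => E.
rewrite (_ : \sum_(_ < _ | _) _ = 0) ?mul0r // -[RHS]E.
apply: eq_big => k; first by rewrite subSS !ltnS leq_subCr // -1?ltnS ltn_ord.
rewrite subSS => ik; have km : (k <= m)%N by rewrite -ltnS ltn_ord.
by rewrite subKn // subnAC.
Qed.

Lemma faulhaber m N :
  \sum_(j < N) (j ^ m)%:R
  = \sum_(k < m.+1) 'C(m, k)%:R * bernoulli (m - k) * (N ^ k.+1)%:R / k.+1%:R.
Proof.
rewrite -[LHS](mulfK (fact_neq0 m)) mulrAC mulr_suml faulhaber_egf mulr_suml.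
apply: eq_bigr => k _; rewrite bin_ratE -1?ltnS ?ltn_ord // factS natrM.
by field; rewrite !fact_neq0 nat1r pnatr_eq0.
Qed.
End Bernoulli.

(** * Rationals of bounded p-adic valuation *)

Section PadicRationals.
Local Open Scope ring_scope.

(* The rationals of p-adic valuation at least r; the primality argument lets the
   additive closure instance below be inferred. *)
Definition pw (p : nat) (_ : prime p) (r : nat) : {pred rat} :=
  [pred q | pintegral p (q / (p ^ r)%:R)].

Variables (p : nat) (p_pr : prime p).
Local Notation "'P" := (pw p_pr).

Lemma expp_neq0 r : (p ^ r)%:R != 0 :> rat.
Proof. by rewrite pnatr_eq0 -lt0n expn_gt0 prime_gt0. Qed.

Lemma pwP r q :
  reflect (exists u : int, exists2 v : nat, ~~ (p %| v)%N
             & q = (p ^ r)%:R * (u%:~R / v%:R))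
          (q \in 'P r).
Proof.
apply: (iffP idP); rewrite inE /pintegral.
  set x := q / _; have := denq_gt0 x; have := divq_num_den x.
  case: (denq x) => // d E _ pd; exists (numq x), d => //.
  by rewrite -[d%:R]/(d%:~R) E mulrC divfK ?expp_neq0.
move=> [u [v pv ->]]; rewrite mulrAC divff ?expp_neq0 // mul1r.
apply: contra pv; rewrite -[v%:R]/(v%:Z%:~R) -[(p %| v)%N]/(p%:Z %| v%:Z)%Z.
by case: divqP => [_|k x k0]; [rewrite dvdz0 | apply: dvdz_mull].
Qed.

Lemma pw_zmod_closed r : zmod_closed ('P r).
Proof.
split; first by apply/pwP; exists 0, 1%N; rewrite ?mul0r ?mulr0 // Euclid_dvd1.
move=> _ _ /pwP[u [v pv ->]] /pwP[u' [v' pv' ->]]; apply/pwP.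
exists (u * v' - u' * v), (v * v')%N; first by rewrite Euclid_dvdM // negb_or pv.
rewrite -mulrBr intrB !intrM natrM; congr (_ * _).
by field; rewrite !pnatr_eq0; apply/andP; split;
  [apply: contraNneq pv' => -> | apply: contraNneq pv => ->]; rewrite dvdn0.
Qed.
HB.instance Definition _ r := GRing.isZmodClosed.Build rat ('P r) (pw_zmod_closed r).

Lemma pwM r s x y : x \in 'P r -> y \in 'P s -> x * y \in 'P (r + s).
Proof.
move=> /pwP[u [v pv ->]] /pwP[u' [v' pv' ->]]; apply/pwP.
exists (u * u'), (v * v')%N; first by rewrite Euclid_dvdM // negb_or pv.
rewrite intrM natrM expnD natrM invfM; ring.
Qed.

Lemma pw_mulX r s x : ((p ^ s)%:R * x \in 'P (s + r)) = (x \in 'P r).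
Proof.
rewrite !inE expnD natrM invfM; congr (pintegral _ _).
by field; rewrite !expp_neq0.
Qed.

Lemma pw_mulX0 s x : ((p ^ s)%:R * x \in 'P s) = (x \in 'P 0).
Proof. by rewrite -{2}[s]addn0 pw_mulX. Qed.

Lemma pw_eqr r x y : x \in 'P r -> x = y -> y \in 'P r.
Proof. by move=> xr <-. Qed.

Lemma pw_int (u : int) : u%:~R \in 'P 0.
Proof. by apply/pwP; exists u, 1%N; rewrite ?Euclid_dvd1 // expn0 mul1r divr1. Qed.

Lemma pw_nat (n : nat) : n%:R \in 'P 0.
Proof. exact: (pw_int n). Qed.

Lemma pw_expp r : (p ^ r)%:R \in 'P r.
Proof. by rewrite -[X in X \in _]mulr1 pw_mulX0 (pw_nat 1). Qed.

Lemma pwMl r x y : x \in 'P 0 -> y \in 'P r -> x * y \in 'P r.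
Proof. exact: pwM. Qed.

Lemma pwMr r x y : x \in 'P r -> y \in 'P 0 -> x * y \in 'P r.
Proof. by move=> xr y0; rewrite mulrC pwMl. Qed.

Lemma pw_dvdn r n : ((n%:R : rat) \in 'P r) = (p ^ r %| n)%N.
Proof.
apply/idP/idP => [/pwP[u [v pv]]|/dvdnP[k ->]]; last first.
  by rewrite natrM pwMl ?pw_nat ?pw_expp.
have v0 : v%:R != 0 :> rat.
  by rewrite pnatr_eq0; apply: contraNneq pv => ->; rewrite dvdn0.
move/(congr1 ( *%R^~ v%:R)); rewrite mulrA divfK //.
rewrite -[(p ^ r)%:R]/((p ^ r)%:Z%:~R) -[n%:R]/(n%:Z%:~R) -[v%:R]/(v%:Z%:~R).
rewrite -!intrM => /intr_inj E.
have : (p ^ r %| n * v)%N.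
  by rewrite -[(_ %| _)%N]/((p ^ r)%:Z %| (n * v)%N%:Z)%Z PoszM E dvdz_mulr.
by rewrite Gauss_dvdl // coprimeXl // prime_coprime.
Qed.

Lemma pw1_dvdn n : ((n%:R : rat) \in 'P 1) = (p %| n)%N.
Proof. by rewrite pw_dvdn expn1. Qed.

Lemma pw_natB r m n : m = n %[mod p ^ r] -> (m%:R - n%:R : rat) \in 'P r.
Proof.
wlog nm : m n / (n <= m)%N => [H|/eqP].
  case: (leqP n m) => [|/ltnW]; first exact: H.
  by move=> mn E; rewrite -opprB rpredN H.
by rewrite eqn_mod_dvd // -natrB // pw_dvdn.
Qed.

Lemma pwW r s x : (s <= r)%N -> x \in 'P r -> x \in 'P s.
Proof.
move=> sr /pwP[u [v pv ->]]; rewrite -(subnKC sr) expnD natrM -mulrA.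
apply: pwMr; first exact: pw_expp.
by rewrite pwMl ?pw_nat //; apply/pwP; exists u, v; rewrite // mul1r.
Qed.

(** The power of p dividing m is at most m < p^(e+1), so its exponent is at most e. *)
Lemma pw_frac e m : (0 < m)%N -> (m < p ^ e.+1)%N -> (p ^ e)%:R / m%:R \in 'P 0.
Proof.
move=> m0 me; have [q pq Eq] := pfactor_coprime p_pr m0.
have le : (logn p m <= e)%N.
  rewrite -ltnS -(ltn_exp2l _ _ (prime_gt1 p_pr)); apply: leq_ltn_trans me.
  by apply: dvdn_leq => //; apply: pfactor_dvdnn.
apply/pwP; exists (p ^ (e - logn p m))%N, q; first by rewrite -prime_coprime.
rewrite {1}Eq -[LHS]mul1r -[(_ ^ (_ - _))%N%:~R]/((p ^ (e - logn p m))%N%:R).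
rewrite -{1}(subnK le) expnD !natrM.
have q0 : q%:R != 0 :> rat.
  by rewrite pnatr_eq0; apply: contraTneq m0 => q0; rewrite Eq q0.
by field; rewrite q0 expp_neq0.
Qed.

Lemma pw_natV n : ~~ (p %| n)%N -> n%:R^-1 \in 'P 0.
Proof. by move=> pn; apply/pwP; exists 1, n; rewrite // !mul1r. Qed.

Lemma pw_natMl r n x : ~~ (p %| n)%N -> (n%:R * x \in 'P r) = (x \in 'P r).
Proof.
move=> pn; apply/idP/idP => [H|]; last exact/pwMl/pw_nat.
have n0 : n%:R != 0 :> rat.
  by rewrite pnatr_eq0; apply: contraNneq pn => ->; rewrite dvdn0.
by rewrite -(mulKf n0 x) pwMl ?pw_natV.
Qed.

Lemma pw_residue x : x \in 'P 0 -> exists2 d, (d < p)%N & x - d%:R \in 'P 1.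
Proof.
case/pwP => u [v pv ->]; rewrite mul1r.
have v0 : v%:R != 0 :> rat.
  by rewrite pnatr_eq0; apply: contraNneq pv => ->; rewrite dvdn0.
have v_gt0 : (0 < v)%N by case: (v) pv => //; rewrite dvdn0.
have [m] : exists m : nat, (u%:~R - m%:R : rat) \in 'P 1.
  case: u => m; first by exists m; rewrite subrr rpred0.
  (* Replacing -1 by p - 1 represents a negative numerator by a natural number modulo p. *)
  exists (m.+1 * p.-1)%N; rewrite NegzE intrN -opprD rpredN.
  rewrite -[m.+1%:~R]/(m.+1%:R) -natrD -mulnS prednK ?prime_gt0 //.
  by rewrite pw_dvdn expn1 dvdn_mull.
have [k1 k2 E _] := egcdnP p v_gt0.
move: E; rewrite (eqP (_ : coprime v p)) ?(coprime_sym v) ?prime_coprime // => E um.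
exists (m * k1 %% p)%N; first by rewrite ltn_mod prime_gt0.
rewrite -(pw_natMl _ _ pv) mulrBr mulrCA divff // mulr1 -natrM.
rewrite -(subrK m%:R u%:~R) -addrA rpredD // pw_natB //.
rewrite expn1 modnMmr mulnCA (mulnC v) E mulnDr muln1 mulnA addnC.
by rewrite addnC modnMDl.
Qed.

Lemma pw_nat_small m n : (m < p)%N -> (n < p)%N -> (m%:R - n%:R : rat) \in 'P 1 -> m = n.
Proof.
wlog nm : m n / (n <= m)%N => [H mp np|mp np].
  case: (leqP n m) => [|/ltnW] nm; first exact: H.
  by rewrite -opprB rpredN => /H->.
rewrite -natrB // pw_dvdn expn1 => /dvdn_leq; lia.
Qed.

Lemma pintegral_pw x : pintegral p x = (x \in 'P 0).
Proof. by rewrite inE expn0 divr1. Qed.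

(** A numerator divisible by p excludes p from the denominator. For r = 0 this fails: [dvdq] is then
    always true, while membership means p-integrality. *)
Lemma dvdq_pw r x : (0 < r)%N -> dvdq (p ^ r) x = (x \in 'P r).
Proof.
move=> r0; have d0 : (denq x)%:~R != 0 :> rat by rewrite intr_eq0 denq_eq0.
have d_gt0 := denq_gt0 x.
apply/idP/pwP => [|[u [v pv E]]].
  rewrite /dvdq => /dvdzP[k Ek]; exists k, `|denq x|%N; last first.
    rewrite -[LHS]divq_num_den Ek natr_absz gtr0_norm // intrM.
    by rewrite mulrA [_ * k%:~R]mulrC.
  apply/negP => pd; have := coprime_num_den x.
  rewrite Ek abszM /= coprimeMl => /andP[_]; rewrite coprime_pexpl //.
  by rewrite prime_coprime // pd.
have v0 : v%:R != 0 :> rat.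
  by rewrite pnatr_eq0; apply: contraNneq pv => ->; rewrite dvdn0.
have : numq x * v%:Z = (p ^ r)%N%:Z * (u * denq x).
  apply: (@intr_inj rat); rewrite !intrM numqE {1}E.
  by rewrite -[v%:~R]/(v%:R) -[(p ^ r)%N%:~R]/((p ^ r)%N%:R); field.
move/(congr1 absz); rewrite !abszM /= /dvdq /dvdz /= => H.
have : (p ^ r %| `|numq x| * v)%N by rewrite H dvdn_mulr.
by rewrite Gauss_dvdl // coprimeXl // prime_coprime.
Qed.
End PadicRationals.

(** * The congruences of von Staudt and Voronoi *)

Section BernoulliCongruences.
Local Open Scope ring_scope.
Variables (p : nat) (p_pr : prime p) (p_odd : odd p).
Local Notation "'P" := (pw p_pr).

Lemma fermat_dvdn j m : (p.-1 %| m)%N -> ~~ (p %| j)%N -> j ^ m = 1 %[mod p].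
Proof.
move=> /dvdnP[k ->] pj; rewrite mulnC expnM -modnXm -totient_prime //.
by rewrite Euler_exp_totient ?modnXm ?exp1n // coprime_sym prime_coprime.
Qed.

(** False for p = 2 and i = 0: here p odd enters the valuation estimates. *)
Lemma ltn_expp i : (i.+2 < p ^ i.+1)%N.
Proof.
have p3 : (2 < p)%N by rewrite odd_prime_gt2.
by elim: i => [|i IHi]; rewrite ?expn1 // expnS; nia.
Qed.

Lemma pw_expp_divS i : (p ^ i)%:R / i.+1%:R \in 'P 0.
Proof. by apply: pw_frac => //; apply: ltn_trans (ltn_expp i). Qed.

Lemma pw_expp_divSS i : (p ^ i)%:R / i.+2%:R \in 'P 0.
Proof. by apply: pw_frac => //; apply: ltn_expp. Qed.

(** At most one of two consecutive integers is divisible by p. *)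
Lemma pw_expp_divS2 i : (p ^ i)%:R / (i.+1 * i.+2)%:R \in 'P 0.
Proof.
rewrite natrM; have [/dvdnP[k Ek]|pi] := boolP (p %| i.+1)%N.
  rewrite invfM mulrA pwMr ?pw_expp_divS // pw_natV // -addn1 Ek.
  by rewrite dvdn_addr ?dvdn_mull // Euclid_dvd1.
by rewrite invfM mulrCA pwMl ?pw_expp_divSS // pw_natV.
Qed.

(** Trades the denominator l + 1, of uncontrolled valuation, for m + 1, which the powers of p in the
    sums below absorb. *)
Lemma bin_divS l m : 'C(l.+1, m.+1)%:R / l.+1%:R = 'C(l, m)%:R / m.+1%:R :> rat.
Proof.
apply/eqP; rewrite eqr_div ?pnatr_eq0 // -!natrM mulnC -mul_bin_diag.
by rewrite mulnC.
Qed.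

(** Faulhaber's formula with N = p: the term k = 0 is p B_m, and the others are p times p-integral
    numbers, since strong induction makes p B_m' p-integral for m' < m. *)
Lemma pbernoulli_power_sum m :
  p%:R * bernoulli m - \sum_(j < p) (j ^ m)%:R \in 'P 1.
Proof.
elim/ltn_ind: m => m IHm.
have int m' : (m' < m)%N -> p%:R * bernoulli m' \in 'P 0.
  move=> /IHm /(pwW (leq0n 1)) H.
  by rewrite -(subrK (\sum_(j < p) (j ^ m')%:R) (_ * _)) rpredD // rpred_sum // => j _;
    rewrite pw_nat.
rewrite faulhaber big_ord_recl /= subn0 bin0 expn1 mul1r divr1 mulrC.
rewrite opprD addNKr rpredN rpred_sum // => i _.
rewrite /bump leq0n add1n expnS natrM.
have -> : 'C(m, i.+1)%:R * bernoulli (m - i.+1) * (p%:R * (p ^ i.+1)%:R) / i.+2%:R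
  = (p ^ 1)%:R * ('C(m, i.+1)%:R * ((p%:R * bernoulli (m - i.+1)) * ((p ^ i)%:R / i.+2%:R))).
  by rewrite expn1 expnS natrM; ring.
rewrite pw_mulX0 pwMl ?pw_nat // pwMr ?pw_expp_divSS // int //.
by have := ltn_ord i; lia.
Qed.

Lemma pbernoulli_int m : p%:R * bernoulli m \in 'P 0.
Proof.
rewrite -(subrK (\sum_(j < p) (j ^ m)%:R) (_ * _)) rpredD //.
  exact: pwW (pbernoulli_power_sum m).
by rewrite rpred_sum // => j _; rewrite pw_nat.
Qed.

Lemma von_staudt m : (0 < m)%N -> (p.-1 %| m)%N -> p%:R * bernoulli m + 1 \in 'P 1.
Proof.
move=> m0 pm.
rewrite -(subrK (\sum_(j < p) (j ^ m)%:R) (_ * _)) -addrA rpredD //.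
  exact: pbernoulli_power_sum.
have E q : (\sum_(j < q.+1) (j ^ m)%:R + 1 : rat)
    = \sum_(j < q) ((j.+1 ^ m)%:R - 1%:R) + q.+1%:R.
  rewrite sumrB sumr_const card_ord big_ord_recl exp0n // -natr1.
  by rewrite (eq_bigr (fun i : 'I_q => (i.+1 ^ m)%:R)) //; ring.
have := E p.-1; rewrite prednK ?prime_gt0 // => ->.
rewrite rpredD ?pw_dvdn ?expn1 // rpred_sum // => j _.
rewrite pw_natB // expn1 fermat_dvdn // gtnNdvd //.
by have := ltn_ord j; lia.
Qed.

(** If B_m/m were p-integral, p B_m would vanish modulo p, against von Staudt. This excludes p - 1 |
    l for irregular pairs and, with p = 3, gives B_l nonzero. *)
Lemma Bhat_nonint m : (0 < m)%N -> (p.-1 %| m)%N -> Bhat m \notin 'P 0.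
Proof.
move=> m0 pm; apply/negP => Bm; have := von_staudt m0 pm.
rewrite -(mulfVK (_ : m%:R != 0) (bernoulli m)) ?pnatr_eq0 -?lt0n // -/(Bhat m).
rewrite rpredDl; last by rewrite pwMr ?pw_dvdn ?expn1 // pwMr ?pw_nat.
by rewrite (pw_dvdn _ 1 1) expn1 Euclid_dvd1.
Qed.

Lemma power_sum_Bhat l K : (0 < l)%N ->
  (\sum_(j < p ^ K.+1) (j ^ l)%:R) / (l * p ^ K.+1)%:R - Bhat l \in 'P K.
Proof.
case: l => // l _; set N := (p ^ K.+1)%N.
have N0 : N%:R != 0 :> rat by rewrite expp_neq0.
rewrite faulhaber mulr_suml big_ord_recl /= subn0 bin0 expn1 mul1r divr1.
rewrite natrM -mulf_div divff // mulr1 -/(Bhat l.+1) addrAC subrr add0r.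
rewrite rpred_sum // => i _; rewrite /bump leq0n add1n.
(* Of p^((K+1)(i+1)), one factor p makes the Bernoulli number p-integral, p^i absorbs the
   denominators i + 1 and i + 2, and p^K remains. *)
have -> : 'C(l.+1, i.+1)%:R * bernoulli (l.+1 - i.+1) * (N ^ i.+2)%:R / i.+2%:R
    / (l.+1%:R * N%:R)
  = (p ^ K)%:R * ('C(l, i)%:R * ((p%:R * bernoulli (l - i))
     * ((p ^ (K * i))%:R * ((p ^ i)%:R / (i.+1 * i.+2)%:R)))).
  rewrite subSS [(N ^ i.+2)%N]expnS [(N * _)%:R]natrM [(_ * i.+2)%:R]natrM.
  transitivity (('C(l.+1, i.+1)%:R / l.+1%:R) * bernoulli (l - i) * (N ^ i.+1)%:R / i.+2%:R).
    by field; rewrite ?nat1r -?natrD ?N0 ?pnatr_eq0.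
  rewrite bin_divS /N -expnM mulSn mulnS.
  rewrite (_ : _ + _ = 1 + (K + (K * i + i)))%N; last by lia.
  by rewrite !expnD expn1 !natrM; field; rewrite ?nat1r -?natrD ?pnatr_eq0.
rewrite pw_mulX0 pwMl ?pw_nat // pwMl ?pbernoulli_int // pwMl ?pw_nat //.
exact: pw_expp_divS2.
Qed.

Lemma sum_multiples (V : nmodType) (F : nat -> V) M :
  \sum_(j < p * M | (p %| j)%N) F j = \sum_(i < M) F (p * i)%N.
Proof.
elim: M => [|M IHM]; first by rewrite muln0 !big_ord0.
rewrite big_ord_recr -IHM /=.
rewrite -(big_mkord (fun j => p %| j)%N) (@big_cat_nat _ _ _ (p * M)) ?leq_mul2l ?leqnSn ?orbT //=.
rewrite big_mkord; congr (_ + _).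
have lt : (p * M < p * M.+1)%N by rewrite ltn_pmul2l ?prime_gt0.
rewrite big_ltn_cond // dvdn_mulr // big_nat_cond big_pred0 ?addr0 // => j.
apply/negP => /andP[/andP[lo hi] /dvdnP[k Ek]].
by move: lo hi; rewrite Ek [(k * p)%N]mulnC !ltn_pmul2l ?prime_gt0 //; lia.
Qed.

(** The multiples of p contribute p^l times the full sum up to p^(K+1), whence the Euler factor. The
    lower precision of that sum is made up by p^(l-1), as l > 1. *)
Lemma coprime_power_sum l K : (1 < l)%N ->
  (\sum_(j < p ^ K.+2 | ~~ (p %| j)%N) (j ^ l)%:R) / (l * p ^ K.+2)%:R
  + (p ^ l.-1 - 1)%:R * Bhat l \in 'P K.+1.
Proof.
move=> l1; have l0 := ltnW l1.
have p0 : p%:R != 0 :> rat by rewrite pnatr_eq0 -lt0n prime_gt0.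
have := @power_sum_Bhat l K.+1 l0; have := @power_sum_Bhat l K l0.
have -> : (\sum_(j < p ^ K.+2) (j ^ l)%:R : rat)
   = (p ^ l)%:R * (\sum_(j < p ^ K.+1) (j ^ l)%:R)
     + \sum_(j < p ^ K.+2 | ~~ (p %| j)%N) (j ^ l)%:R.
  rewrite (bigID (fun j : 'I__ => (p %| j)%N)) /=; congr (_ + _).
  rewrite (expnS p K.+1) (sum_multiples (fun j => (j ^ l)%:R)) mulr_sumr.
  by apply: eq_bigr => i _; rewrite expnMn natrM.
set T := \sum_(j < _) _; set U := \sum_(j < _ | _) _.
move=> H1 H2.
have H3 : (p ^ l.-1)%:R * (T / (l * p ^ K.+1)%:R - Bhat l) \in 'P K.+1.
  have /pwM/(_ H1) : (p ^ l.-1)%:R \in 'P 1.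
    by rewrite pw_dvdn expn1 dvdn_exp // -ltnS prednK.
  by rewrite add1n.
apply: pw_eqr (rpredB H2 H3) _.
rewrite natrB ?expn_gt0 ?prime_gt0 // -{1}(prednK l0) (expnS p l.-1).
rewrite (expnS p K.+1) !natrM; field.
by apply/and3P; split; rewrite ?p0 ?expp_neq0 ?pnatr_eq0 -?lt0n.
Qed.

(** First-order expansion of the l-th power; [bin_divS] controls the division by l in the higher
    terms, even when p divides l. *)
Lemma expr_shift r c l K : (0 < l)%N ->
  (((r + p ^ K.+1 * c) ^ l)%:R - (r ^ l)%:R) / (l * p ^ K.+1)%:R
  - (c * r ^ l.-1)%:R \in 'P K.
Proof.
case: l => // l _ /=; set N := (p ^ K.+1)%N.
have N0 : N%:R != 0 :> rat by rewrite expp_neq0.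
have l0 : l.+1%:R != 0 :> rat by rewrite pnatr_eq0.
rewrite expnDn natr_sum big_ord_recl big_ord_recl /= /bump /=.
rewrite bin0 bin1 subn0 subn1 /= !mul1n muln1 expn1.
set R := \sum_(i < _) _.
have -> : ((r ^ l.+1)%:R + ((l.+1 * (r ^ l * (N * c)))%:R + R) - (r ^ l.+1)%:R)
   / (l.+1 * N)%:R - (c * r ^ l)%:R = R / (l.+1%:R * N%:R).
  by rewrite !natrM; field; rewrite N0 nat1r.
rewrite mulr_suml rpred_sum // => i _.
have -> : ('C(l.+1, 1 + (1 + i)) * (r ^ (l.+1 - (1 + (1 + i))) * (N * c) ^ (1 + (1 + i))))%:R
     / (l.+1%:R * N%:R)
  = (p ^ K)%:R * (('C(l, i.+1) * r ^ (l - i.+1) * c ^ i.+2)%:R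
     * ((p ^ (K * i))%:R * ((p ^ i.+1)%:R / i.+2%:R))) :> rat.
  rewrite !add1n subSS expnMn [(N ^ i.+2)%N]expnS.
  transitivity (('C(l.+1, i.+2)%:R / l.+1%:R) * (N ^ i.+1)%:R
    * (r ^ (l - i.+1) * c ^ i.+2)%:R : rat).
    by rewrite !natrM; field; rewrite ?nat1r -?natrD ?N0 ?pnatr_eq0.
  rewrite bin_divS /N -expnM mulSn mulnS.
  rewrite (_ : _ + _ = K + (K * i + i.+1))%N; last by lia.
  by rewrite !expnD !natrM; field; rewrite ?nat1r -?natrD ?pnatr_eq0.
by rewrite pw_mulX0 pwMl ?pw_nat // pwMl ?pw_nat // pw_expp_divS.
Qed.

Definition voronoi_sum (a l K : nat) : nat :=
  (\sum_(j < p ^ K | ~~ (p %| j)%N) (a * j %/ p ^ K) * (a * j %% p ^ K) ^ l)%N.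

Lemma perm_mulmod (V : nmodType) (F : nat -> V) a K : ~~ (p %| a)%N -> (0 < K)%N ->
  \sum_(j < p ^ K | ~~ (p %| j)%N) F (a * j %% p ^ K)%N
  = \sum_(j < p ^ K | ~~ (p %| j)%N) F j.
Proof.
move=> pa K0; have N0 : (0 < p ^ K)%N by rewrite expn_gt0 prime_gt0.
pose h (j : 'I_(p ^ K)) := Ordinal (ltn_pmod (a * j) N0).
have h_inj : injective h.
  move=> i j /(congr1 val) /= E; apply: val_inj => /=.
  wlog ij : i j E / (i <= j)%N => [H|].
    by case: (leqP i j) => [|/ltnW] ij; [apply: H | symmetry; apply: H].
  have: (p ^ K %| a * (j - i))%N by rewrite mulnBr -eqn_mod_dvd ?leq_mul2l ?ij ?orbT // E.
  rewrite Gauss_dvdr ?coprimeXl ?prime_coprime // => /dvdn_leq.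
  by have := ltn_ord j; lia.
rewrite [RHS](reindex_inj h_inj) /=; apply: eq_bigl => j.
rewrite [in RHS]/dvdn modn_dvdm ?dvdn_exp // -/(dvdn _ _).
by rewrite Euclid_dvdM // (negPf pa).
Qed.

(** Write a j = r + p^(K+2) c with r the residue, and let S be the sum of j^l over j prime to p. The
    sum of (a j)^l is a^l S; since the r permute the j, [expr_shift] also makes it S plus l p^(K+2)
    times the Voronoi sum. Then [coprime_power_sum] evaluates S. *)
Lemma voronoi a l K : ~~ (p %| a)%N -> (1 < l)%N ->
  ((a ^ l - 1) * (p ^ l.-1 - 1))%:R * Bhat l + (voronoi_sum a l.-1 K.+2)%:R
    \in 'P K.+1.
Proof.
move=> pa l1; have l0 := ltnW l1.
have a0 : (0 < a)%N by rewrite lt0n; apply: contraNneq pa => ->; rewrite dvdn0.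
have := pwMl (pw_nat p_pr (a ^ l - 1)) (@coprime_power_sum l K l1).
set T := \sum_(j < _ | _) _ => H1.
have H2 : (a ^ l - 1)%:R * (T / (l * p ^ K.+2)%:R) - (voronoi_sum a l.-1 K.+2)%:R \in 'P K.+1.
  have -> : (a ^ l - 1)%:R * (T / (l * p ^ K.+2)%:R) - (voronoi_sum a l.-1 K.+2)%:R
    = \sum_(j < p ^ K.+2 | ~~ (p %| j)%N)
       ((((a * j %% p ^ K.+2 + p ^ K.+2 * (a * j %/ p ^ K.+2)) ^ l)%:R
         - ((a * j %% p ^ K.+2) ^ l)%:R) / (l * p ^ K.+2)%:R
      - (a * j %/ p ^ K.+2 * (a * j %% p ^ K.+2) ^ l.-1)%:R).
    rewrite sumrB -mulr_suml sumrB natr_sum; congr (_ - _).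
    rewrite mulrA natrB ?expn_gt0 ?a0 // mulrBl mul1r; congr ((_ - _) / _).
      rewrite mulr_sumr; apply: eq_bigr => j _.
      rewrite -natrM -expnMn {1}(divn_eq (a * j) (p ^ K.+2)) addnC.
      by rewrite [X in (_ + X)%N]mulnC.
    exact: esym (perm_mulmod (fun j => (j ^ l)%:R) pa (ltn0Sn _)).
  by rewrite rpred_sum // => j _; apply: expr_shift.
apply: pw_eqr (rpredB H1 H2) _.
by rewrite natrM; ring.
Qed.

End BernoulliCongruences.

(** The quadratic term is explicit because, for m = p and u = p y, an unspecified multiple of u^2
    would be too coarse: its coefficient supplies one more factor p. *)
Lemma expn_1D u m : exists w, (1 + u) ^ m = 1 + m * u + 'C(m, 2) * u ^ 2 + u ^ 3 * w.
Proof.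
elim: m => [|m [w IHm]]; first by exists 0; rewrite muln0.
exists ('C(m, 2) + w + u * w).
by rewrite expnS IHm binS bin1 !expnS expn0; ring.
Qed.

(** * Kummer congruences *)

Section Kummer.
Variables (p : nat) (p_pr : prime p) (p_odd : odd p).
Local Notation "'P" := (pw p_pr).

Definition fermat_quotient r := (r ^ p.-1 - 1) %/ p.

Lemma fermat_quotientE r : ~~ (p %| r) -> r ^ p.-1 = 1 + p * fermat_quotient r.
Proof.
move=> pr; have r0 : 0 < r by rewrite lt0n; apply: contraNneq pr => ->; rewrite dvdn0.
rewrite mulnC divnK ?subnKC ?expn_gt0 ?r0 //.
by rewrite -eqn_mod_dvd ?expn_gt0 ?r0 // (fermat_dvdn p_pr).
Qed.

(** For p odd, the p-th power of 1 + p^(n+1) y is 1 + p^(n+2) y modulo p^(n+3). So one Fermat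
    quotient governs all levels, and the slope will not depend on n. *)
Lemma expn_totient_pfactor r n : ~~ (p %| r) ->
  exists z, r ^ (p.-1 * p ^ n) = 1 + p ^ n.+1 * (fermat_quotient r + p * z).
Proof.
move=> pr; elim: n => [|n [z IHn]].
  by exists 0; rewrite muln1 fermat_quotientE // expn1 muln0 addn0.
rewrite expnSr mulnA expnM IHn; move Ey: (_ + p * z) => y.
have [w ->] := expn_1D (p ^ n.+1 * y) p.
exists (z + p ^ n * p.-1./2 * y ^ 2 + p ^ (n + n) * y ^ 3 * w).
set A := p ^ n * _ * _; set B := p ^ (n + n) * _ * _.
have -> : fermat_quotient r + p * (z + A + B) = y + p * (A + B) by rewrite -Ey; ring.
by rewrite bin2odd // /A /B !(expnS, expnD); ring.
Qed.

Lemma expn_shift r e n t : ~~ (p %| r) ->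
  exists w, r ^ (e + p.-1 * p ^ n * t)
    = r ^ e + t * p ^ n.+1 * (r ^ e * fermat_quotient r) + p ^ n.+2 * w.
Proof.
move=> pr; rewrite expnD expnM; have [z ->] := expn_totient_pfactor n pr.
move Ey: (_ + p * z) => y; have [w ->] := expn_1D (p ^ n.+1 * y) t.
exists (r ^ e * (t * z + 'C(t, 2) * p ^ n * y ^ 2 + p ^ (n + n.+1) * y ^ 3 * w)).
have -> : t * (p ^ n.+1 * y) = t * p ^ n.+1 * fermat_quotient r + p ^ n.+2 * (t * z).
  by rewrite -Ey !expnS; ring.
by rewrite !(expnS, expnD); ring.
Qed.

(** Modulo p, the derivative of [voronoi_sum] along the exponents e + (p-1) x, divided by p: by
    [expn_shift] each power acquires its Fermat quotient. *)
Definition voronoi_slope a e K :=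
  \sum_(j < p ^ K | ~~ (p %| j)) (a * j %/ p ^ K)
    * ((a * j %% p ^ K) ^ e * fermat_quotient (a * j %% p ^ K)).

Lemma ndvdn_mulmod a j K : 0 < K -> ~~ (p %| a) -> ~~ (p %| j) ->
  ~~ (p %| a * j %% p ^ K).
Proof.
move=> K0 pa pj; rewrite /dvdn modn_dvdm ?dvdn_exp // -/(dvdn _ _).
by rewrite Euclid_dvdM // negb_or pa.
Qed.

Local Open Scope ring_scope.

Lemma voronoi_sum_shift a e n t K : (0 < K)%N -> ~~ (p %| a)%N ->
  (voronoi_sum p a (e + p.-1 * p ^ n * t) K)%:R - (voronoi_sum p a e K)%:R
   - (t * p ^ n.+1 * voronoi_slope a e K)%:R \in 'P n.+2.
Proof.
move=> K0 pa; rewrite !natr_sum natrM natr_sum mulr_sumr -!sumrB rpred_sum // => j pj.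
have [w ->] := expn_shift e n t (ndvdn_mulmod K0 pa pj).
set r := (_ %% _)%N; set c := (_ %/ _)%N.
have -> : (c * (r ^ e + t * p ^ n.+1 * (r ^ e * fermat_quotient r) + p ^ n.+2 * w))%:R
   - (c * r ^ e)%:R - (t * p ^ n.+1)%:R * (c * (r ^ e * fermat_quotient r))%:R
   = (p ^ n.+2)%:R * (c * w)%:R :> rat.
  by rewrite !(natrM, natrD); ring.
by rewrite pw_mulX0 pw_nat.
Qed.

Lemma voronoi_slope_shift a e x K : (0 < K)%N -> ~~ (p %| a)%N ->
  (voronoi_slope a (e + p.-1 * x) K)%:R - (voronoi_slope a e K)%:R \in 'P 1.
Proof.
move=> K0 pa; rewrite !natr_sum -!sumrB rpred_sum // => j pj.
set r := (_ %% _)%N.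
have Er : r ^ (e + p.-1 * x) = r ^ e %[mod p].
  by rewrite expnD -modnMmr (fermat_dvdn p_pr) ?dvdn_mulr ?ndvdn_mulmod // modnMmr muln1.
by rewrite pw_natB // expn1 -modnMmr -(modnMml (r ^ (e + _))) Er modnMml modnMmr.
Qed.

Definition euler_factor a l := ((a ^ l - 1) * (p ^ l.-1 - 1))%N.

(* The opposite of (a^l - 1)(1 - p^(l-1)) B_l / l, so that the factor is in nat. *)
Definition reg_Bhat a l : rat := (euler_factor a l)%:R * Bhat l.

Lemma reg_Bhat_shift a l n t K : (n <= K)%N -> ~~ (p %| a)%N -> (1 < l)%N ->
  reg_Bhat a (l + p.-1 * p ^ n * t) - reg_Bhat a l
    + (t * p ^ n.+1 * voronoi_slope a l.-1 K.+3)%:R \in 'P n.+2.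
Proof.
move=> nK pa l1; have nK2 : (n.+2 <= K.+2)%N by [].
have l1' : (1 < l + p.-1 * p ^ n * t)%N by apply: leq_trans l1 (leq_addr _ _).
have := rpredB (rpredB (pwW nK2 (voronoi p_pr p_odd K.+1 pa l1'))
  (pwW nK2 (voronoi p_pr p_odd K.+1 pa l1))) (voronoi_sum_shift l.-1 n t (ltn0Sn K.+2) pa).
move/pw_eqr; apply.
have -> : (l + p.-1 * p ^ n * t).-1 = (l.-1 + p.-1 * p ^ n * t)%N by lia.
rewrite /reg_Bhat /euler_factor.
have -> : (l + p.-1 * p ^ n * t).-1 = (l.-1 + p.-1 * p ^ n * t)%N by lia.
ring.
Qed.

(** The slope has to be freed from the level K and from x; [D] is the one at level 3 and x = 0. *)
Lemma kummer a l : ~~ (p %| a)%N -> (1 < l)%N ->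
  exists D : nat, forall n x t,
    reg_Bhat a (l + p.-1 * (x + p ^ n * t)) - reg_Bhat a (l + p.-1 * x)
    + (t * p ^ n.+1 * D)%:R \in 'P n.+2.
Proof.
move=> pa l1; exists (voronoi_slope a l.-1 3) => n x t.
have lx1 : (1 < l + p.-1 * x)%N by apply: leq_trans l1 (leq_addr _ _).
(* Both slopes describe the same difference, for n = 0 and t = 1, modulo p^2; cancelling p shows
   that they agree modulo p. *)
have D0 K : (voronoi_slope a l.-1 K.+3)%:R - (voronoi_slope a l.-1 3)%:R \in 'P 1.
  have := rpredB (reg_Bhat_shift 1 (leq0n K) pa l1) (reg_Bhat_shift 1 (leqnn 0) pa l1).
  rewrite !mul1n opprD addrACA subrr add0r !natrM -mulrBr.
  by rewrite (pw_mulX _ 1 1).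
have := reg_Bhat_shift t (leqnn n) pa lx1.
rewrite mulnDr mulnA addnA => H; move: (H).
rewrite -(rpredDr _ (_ : (t * p ^ n.+1)%:R *
  ((voronoi_slope a l.-1 3)%:R - (voronoi_slope a (l + p.-1 * x).-1 n.+3)%:R) \in 'P n.+2)).
  move/pw_eqr; apply; rewrite !natrM; ring.
rewrite natrM -mulrA pwMl ?pw_nat // -[n.+2]addn1 pw_mulX -opprB rpredN.
rewrite -(subrK (voronoi_slope a l.-1 n.+3)%:R (voronoi_slope _ _ _)%:R) -addrA.
rewrite rpredD ?D0 // (_ : (l + p.-1 * x).-1 = (l.-1 + p.-1 * x)%N); last by lia.
by rewrite addn1 voronoi_slope_shift.
Qed.

(** The witness is a primitive root modulo p: its order p - 1 does not divide l. *)
Lemma exists_nonroot l : ~~ (p.-1 %| l)%N -> exists2 a, ~~ (p %| a)%N & ~~ (p %| a ^ l - 1)%N.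
Proof.
move=> pl; have /cyclicP[x Ex] := field_unit_group_cyclic [set: {unit 'F_p}]%G.
have ox : #[x]%g = p.-1 by rewrite /order -Ex card_finField_unit card_Fp.
have xl : (x ^+ l)%g != 1%g by rewrite -order_dvdn ox.
have a_nat : (val (val x))%:R = val x :> 'F_p by rewrite natr_Zp.
have pa : ~~ (p %| val (val x))%N.
  by rewrite (dvdn_pcharf (pchar_Fp p_pr)) a_nat -unitfE; exact: valP x.
exists (val (val x)) => //.
have a0 : (0 < val (val x))%N by rewrite lt0n; apply: contraNneq pa => ->; rewrite dvdn0.
rewrite (dvdn_pcharf (pchar_Fp p_pr)) natrB ?expn_gt0 ?a0 // natrX a_nat subr_eq0.
apply: contra xl => /eqP E; apply/eqP/val_inj.
by rewrite /= FinRing.val_unitX E.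
Qed.
End Kummer.

(** * Lifting of zeros *)

Section HenselLifting.
Local Open Scope ring_scope.
Variables (p : nat) (p_pr : prime p).
Local Notation "'P" := (pw p_pr).
Variables (f : nat -> rat) (D : nat).
Hypothesis f_affine : forall n x t,
  f (x + p ^ n * t) - f x + (t * p ^ n.+1 * D)%:R \in 'P n.+2.

(** The slope p D brings one factor p, so f modulo p^(n+1) depends on only n digits of x. *)
Lemma root_mod n x : (f (x %% p ^ n) \in 'P n.+1) = (f x \in 'P n.+1).
Proof.
rewrite [in RHS](divn_eq x (p ^ n)) addnC [(_ %/ _ * _)%N]mulnC.
have /(pwW (leqnSn _)) H := f_affine n (x %% p ^ n) (x %/ p ^ n).
rewrite -(subrK (f (x %% p ^ n)) (f (_ + _))) [RHS]rpredDl //.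
have := rpredB H (_ : (x %/ p ^ n * p ^ n.+1 * D)%:R \in 'P n.+1).
by rewrite addrK; apply; rewrite pw_dvdn mulnAC dvdn_mull.
Qed.

Hypothesis pD : ~~ (p %| D)%N.

(** If y = x + p^n t, the values differ by -t p^(n+1) D modulo p^(n+2), so p divides t. *)
Lemma root_unique n x y :
  f x \in 'P n.+1 -> f y \in 'P n.+1 -> x = y %[mod p ^ n].
Proof.
elim: n x y => [|n IHn] x y; first by rewrite !modn1.
wlog xy : x y / (x <= y)%N => [H|] fx fy.
  by case: (leqP x y) => [|/ltnW] h; [apply: H | symmetry; apply: H].
have /eqP := IHn _ _ (pwW (leqnSn _) fx) (pwW (leqnSn _) fy).
rewrite eq_sym eqn_mod_dvd // => /dvdnP[t Et].
have Ey : y = (x + p ^ n * t)%N by rewrite mulnC -Et subnKC.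
have := rpredB (f_affine n x t) (rpredB fy fx).
rewrite -Ey addrAC subrr add0r -mulnA mulnCA natrM -[n.+2]addn1 pw_mulX pw_dvdn expn1.
rewrite Euclid_dvdM // (negPf pD) orbF => /dvdnP[k Ek].
by rewrite Ey Ek mulnCA -expnSr addnC modnMDl.
Qed.

Lemma root_exists : f 0 \in 'P 1 ->
  forall n, exists x, (x < p ^ n)%N && (f x \in 'P n.+1).
Proof.
move=> f0; elim=> [|n [x /andP[xn fx]]]; first by exists 0%N.
have D0 : D%:R != 0 :> rat by rewrite pnatr_eq0; apply: contraNneq pD => ->; rewrite dvdn0.
have Xn0 := expp_neq0 p_pr n.+1.
(* The next digit t has to solve f(x) = t p^(n+1) D modulo p^(n+2). *)
have : f x / ((p ^ n.+1)%:R * D%:R) \in 'P 0.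
  rewrite invfM mulrA pwMr ?pw_natV //.
  by rewrite -(pw_mulX0 _ n.+1) mulrC divfK.
case/pw_residue => t tp Ht; exists (x + p ^ n * t)%N; apply/andP; split.
  by rewrite expnSr; have := expn_gt0 p n; nia.
have := pwMl (pw_nat p_pr D) Ht; rewrite -(pw_mulX _ _ n.+1) addn1.
move=> /(rpredD (f_affine n x t)) /pw_eqr; apply.
by rewrite !natrM; field; rewrite D0 expp_neq0.
Qed.
End HenselLifting.

(** * Bernoulli quotients along one residue class modulo p - 1 *)

Section ResidueClass.
Local Open Scope ring_scope.
Variables (p : nat) (p_pr : prime p) (p_odd : odd p).
Local Notation "'P" := (pw p_pr).
Variables (l1 : nat) (l1_gt1 : (1 < l1)%N).
Variables (a : nat) (pa : ~~ (p %| a)%N) (pal : ~~ (p %| a ^ l1 - 1)%N).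

Local Notation c := (a ^ l1 - 1)%N.

Lemma expn_class x : a ^ (l1 + p.-1 * x) = a ^ l1 %[mod p].
Proof. by rewrite expnD -modnMmr (fermat_dvdn p_pr) ?dvdn_mulr // modnMmr muln1. Qed.

Lemma euler_factor_cong x :
  (euler_factor p a (l1 + p.-1 * x))%:R + c%:R \in 'P 1.
Proof.
have a0 : (0 < a)%N by rewrite lt0n; apply: contraNneq pa => ->; rewrite dvdn0.
rewrite /euler_factor; set l := (l1 + _)%N.
have pl : (p ^ l.-1)%:R \in 'P 1.
  by rewrite pw_dvdn expn1 dvdn_exp // /l; lia.
have al : (a ^ l)%:R - (a ^ l1)%:R \in 'P 1 by rewrite pw_natB // expn1 expn_class.
have := rpredB (pwMl (pw_nat p_pr (a ^ l - 1)) pl) al.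
move/pw_eqr; apply; rewrite natrM !natrB ?expn_gt0 ?a0 ?prime_gt0 //; ring.
Qed.

Lemma ndvdn_euler_factor x : ~~ (p %| euler_factor p a (l1 + p.-1 * x))%N.
Proof.
apply: contra pal; rewrite -!(pw1_dvdn p_pr) => H.
by have := euler_factor_cong x; rewrite rpredDl.
Qed.

Lemma reg_Bhat_pw n x : (reg_Bhat p a (l1 + p.-1 * x) \in 'P n) = (Bhat (l1 + p.-1 * x) \in 'P n).
Proof. by rewrite pw_natMl // ndvdn_euler_factor. Qed.

Variable D : nat.
Hypothesis kummer_D : forall n x t,
  reg_Bhat p a (l1 + p.-1 * (x + p ^ n * t)) - reg_Bhat p a (l1 + p.-1 * x)
    + (t * p ^ n.+1 * D)%:R \in 'P n.+2.

Lemma totient_pS n : totient (p ^ n.+1) = (p.-1 * p ^ n)%N.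
Proof. exact: totient_pfactor. Qed.

(** Both values of [Bhat] are divisible by p^(n+1), so replacing their Euler factors by -(a^l1 - 1)
    costs only multiples of p^(n+2); the congruence for t = 1 is then divided by p^(n+1). *)
Lemma Delta_slope n x (y := (p ^ n.+1)%:R^-1 *
    (Bhat (l1 + p.-1 * x + totient (p ^ n.+1)) - Bhat (l1 + p.-1 * x))) :
  Bhat (l1 + p.-1 * x) \in 'P n.+1 -> c%:R * y - D%:R \in 'P 1.
Proof.
move=> Bl; rewrite /y totient_pS -addnA -mulnDr => {y}.
set l := (l1 + p.-1 * x)%N; set L := (l1 + _)%N.
have H : reg_Bhat p a L - reg_Bhat p a l + (p ^ n.+1 * D)%:R \in 'P n.+2.
  by have := kummer_D n x 1; rewrite muln1 mul1n.
have BL : Bhat L \in 'P n.+1.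
  rewrite -reg_Bhat_pw -(rpredBr _ (_ : reg_Bhat p a l \in 'P n.+1)) ?reg_Bhat_pw //.
  rewrite -(rpredDr _ (_ : (p ^ n.+1 * D)%:R \in 'P n.+1)).
    exact: pwW H.
  by rewrite natrM pwMr ?pw_expp ?pw_nat.
have := rpredB (rpredB (pwM (euler_factor_cong (x + p ^ n)) BL) (pwM (euler_factor_cong x) Bl)) H.
rewrite -/L -/l add1n -(pw_mulX _ 1 n.+1) addn1; move/pw_eqr; apply.
rewrite /reg_Bhat natrM; field; exact: expp_neq0.
Qed.

(** The right-hand side involves neither n nor x: this is the constancy of Delta. Multiplying by the
    unit a^l1 - 1 turns one predicate into the other. *)
Lemma DeltaE n x : Bhat (l1 + p.-1 * x) \in 'P n.+1 ->
  Delta n.+1 p (l1 + p.-1 * x)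
    = oapp val 0%N [pick d : 'I_p | c%:R * d%:R - D%:R \in 'P 1].
Proof.
move=> Bl; congr (oapp _ _); apply: eq_pick => d /=.
have := Delta_slope Bl; set y := _^-1 * _ => Hy.
have y0 : y \in 'P 0.
  rewrite -(pw_natMl p_pr _ _ pal) -(subrK D%:R (_ * y)) rpredD ?pw_nat //.
  exact: pwW Hy.
rewrite /eqq_mod !(pintegral_pw p_pr) y0 pw_nat dvdq_pw //.
rewrite -(pw_natMl p_pr _ _ pal) -[in RHS](subrK (c%:R * y) (_ * d%:R)) -addrA.
by rewrite [RHS]rpredDr // mulrBr.
Qed.

Lemma Delta_neq0 n x : Bhat (l1 + p.-1 * x) \in 'P n.+1 ->
  Delta n.+1 p (l1 + p.-1 * x) <> 0%N -> ~~ (p %| D)%N.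
Proof.
(* If no residue were picked, [Delta] would be its default 0, against the hypothesis. *)
move=> Bl; rewrite DeltaE //; case: pickP => [d|_] //= Hd d0.
apply/negP => pD; apply: d0.
have /(rpredDr _) E : D%:R \in 'P 1 by rewrite pw_dvdn expn1.
apply: (pw_nat_small (ltn_ord d) (prime_gt0 p_pr)).
by rewrite subr0 -(pw_natMl p_pr _ _ pal) -(subrK D%:R (_ * _)) E.
Qed.

End ResidueClass.

Lemma Bhat_neq0 l : 0 < l -> ~~ odd l -> Bhat l != 0%R.
Proof.
move=> l0 l_even.
have := @Bhat_nonint 3 isT isT l l0; rewrite dvdn2 l_even => /(_ isT).
by apply: contraNneq => ->; rewrite rpred0.
Qed.

(** * Irregular pairs *)

Section IrregularPairs.
Variables (p : nat) (p_pr : prime p) (p_odd : odd p).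

Lemma Psi_irrS n l : ((p, l) \in Psi_irr n.+1)
  = [&& ~~ odd l, 1 < l, l < p.-1 * p ^ n & Bhat l \in pw p_pr n.+1].
Proof. by rewrite !inE p_pr p_odd (dvdq_pw p_pr) // totient_pS. Qed.

Lemma Psi_irr_ndvdn n l : (p, l) \in Psi_irr n.+1 -> ~~ (p.-1 %| l).
Proof.
rewrite Psi_irrS => /and4P[_ l1 _ Bl]; apply: contraL Bl => pl.
apply: contra (Bhat_nonint p_pr p_odd (ltnW l1) pl); exact: pwW.
Qed.

(** Modulo p the regularized quotient is constant on the class of l. The residue is not 0, as p - 1
    does not divide l, nor 1, as l and p - 1 are even. *)
Lemma Psi_irr_mod n l :
  (p, l) \in Psi_irr n.+1 -> (p, l %% p.-1) \in Psi_irr 1.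
Proof.
move=> Pl; have pl := Psi_irr_ndvdn Pl; move: Pl.
rewrite !Psi_irrS => /and4P[l_even l_gt1 _ Bl].
set l' := l %% p.-1; have El : l = l' + p.-1 * (l %/ p.-1).
  by rewrite mulnC addnC -divn_eq.
have p1 : 0 < p.-1 by have := odd_prime_gt2 p_odd p_pr; lia.
have l'_even : ~~ odd l'.
  by move: l_even; rewrite El oddD oddM -subn1 oddB ?prime_gt0 // p_odd addbF.
have l'_gt1 : 1 < l' by move: pl l'_even; rewrite /dvdn -/l'; case: (l') => [|[]].
rewrite l'_even l'_gt1 muln1 ltn_pmod //=.
have [|a pa pal] := @exists_nonroot _ p_pr l'.
  by rewrite gtnNdvd ?ltn_pmod // ltnW.
have [D HD] := kummer p_pr p_odd pa l'_gt1.
have := reg_Bhat_pw p_pr p_odd l'_gt1 pa pal 1 0; rewrite muln0 addn0 => <-.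
have := root_mod HD 0 (l %/ p.-1); rewrite modn1 muln0 addn0 => ->.
by rewrite (reg_Bhat_pw p_pr p_odd) // -El; apply: pwW Bl.
Qed.

(** [x_ n] is the zero modulo p^(n+1) lying below p^n, so it belongs to the pair of order n + 1; the
    [x_ n] are the truncations of one p-adic integer. *)
Lemma irregular_lift l1 : (p, l1) \in Psi_irr 1 -> Delta 1 p l1 <> 0 ->
  exists x_ : nat -> nat,
  [/\ forall n, x_ n < p ^ n,
      forall n, x_ n = x_ n.+1 %% p ^ n,
      forall n l, (p, l) \in Psi_irr n.+1 /\ l = l1 %[mod p.-1]
                  <-> l = l1 + p.-1 * x_ n
    & forall n, Delta n.+1 p (l1 + p.-1 * x_ n) = Delta 1 p l1].
Proof.
move=> Pl1 Dl1; have pl1 := Psi_irr_ndvdn Pl1; move: (Pl1).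
rewrite Psi_irrS muln1 => /and4P[l1_even l1_gt1 l1p Bl1].
have [a pa pal] := exists_nonroot p_pr pl1.
have [D HD] := kummer p_pr p_odd pa l1_gt1.
have WB := reg_Bhat_pw p_pr p_odd l1_gt1 pa pal.
have W0 : reg_Bhat p a (l1 + p.-1 * 0) \in pw p_pr 1 by rewrite WB muln0 addn0.
have pD : ~~ (p %| D).
  by apply: (Delta_neq0 (n := 0) (x := 0) p_odd l1_gt1 pa pal HD); rewrite muln0 addn0.
have ex := root_exists HD pD W0.
pose x_ n := xchoose (ex n).
have x_P n : x_ n < p ^ n /\ Bhat (l1 + p.-1 * x_ n) \in pw p_pr n.+1.
  by have /andP[] := xchooseP (ex n); rewrite -/(x_ n) WB.
clearbody x_.
have uniq n x : x < p ^ n -> Bhat (l1 + p.-1 * x) \in pw p_pr n.+1 -> x = x_ n.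
  move=> xn; have [yn] := x_P n; rewrite -!WB => fy fx.
  by have := root_unique HD pD fx fy; rewrite !modn_small.
have pn0 n : 0 < p ^ n by rewrite expn_gt0 prime_gt0.
exists x_; split=> [n|n|n l|n]; first by case: (x_P n).
(* The truncation of [x_ n.+1] is still a zero modulo p^(n+1), and uniqueness identifies it. *)
- apply/esym/uniq; first by rewrite ltn_mod.
  have [_] := x_P n.+1; rewrite -WB => /(pwW (leqnSn _)).
  by rewrite -(root_mod HD) WB.
- split=> [[+ El]|->].
    have -> : l = l1 + p.-1 * (l %/ p.-1).
      by rewrite -(modn_small l1p) -El addnC mulnC -divn_eq.
    move: (l %/ p.-1) => x; rewrite Psi_irrS => /and4P[_ _ xn Bx].
    rewrite (uniq n x) // -(ltn_pmul2l (leq_ltn_trans (leq0n l1) l1p)).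
    exact: leq_ltn_trans (leq_addl _ _) xn.
  split; last by rewrite addnC mulnC modnMDl.
  have [xn Bx] := x_P n; rewrite Psi_irrS Bx andbT; apply/and3P; split.
  + by rewrite oddD oddM -subn1 oddB ?prime_gt0 // p_odd addbF.
  + exact: leq_trans l1_gt1 (leq_addr _ _).
  + have : p.-1 * (x_ n).+1 <= p.-1 * p ^ n by rewrite leq_mul2l xn orbT.
    by apply: leq_trans; rewrite mulnS ltn_add2r.
- have Bx := (x_P n).2; rewrite (DeltaE p_odd l1_gt1 pa pal HD Bx).
  have := DeltaE (n := 0) (x := 0) p_odd l1_gt1 pa pal HD.
  by rewrite muln0 addn0 => ->.
Qed.

Lemma padic_index_digits s n :
  padic_index p (digits s n.+1) = padic_index p (digits s n) + s n.+1 * totient (p ^ n).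
Proof.
have E m : padic_index p (digits s m) = \sum_(v < m) s v.+1 * totient (p ^ v).
  by apply: eq_bigr => v _; rewrite tnth_mktuple.
by rewrite !E big_ord_recr.
Qed.

(** Reduction modulo p - 1 is a bijection onto the pairs of order 1: by [irregular_lift] each fibre
    is a single pair. *)
Lemma card_irr n : 0 < i_ 1 p -> Delta_prime p = 1 -> i_ n.+1 p = i_ 1 p.
Proof.
move=> i0 /eqP; rewrite /Delta_prime eqb1 => /forallP Dp.
have tot1 : totient (p ^ 1) = p.-1 by rewrite expn1 totient_prime.
have p1 : 0 < totient (p ^ 1) by rewrite totient_gt0 expn1 prime_gt0.
have lift l1 : (p, l1) \in Psi_irr 1 -> Delta 1 p l1 <> 0.
  move=> Pl1; have lt : l1 < totient (p ^ 1) by case/and5P: Pl1 => _ _ _ _ /andP[].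
  by have := Dp (Ordinal lt); rewrite /= Pl1 => /eqP.
pose h (l : 'I_(totient (p ^ n.+1))) := Ordinal (ltn_pmod l p1).
rewrite /i_ -(card_in_imset (f := h)); last first.
  move=> l l'; rewrite !inE => Pl Pl' /(congr1 val) /= E; apply: val_inj.
  have Pm := Psi_irr_mod Pl; have [x_ [_ _ H _]] := irregular_lift Pm (lift _ Pm).
  rewrite tot1 in E.
  transitivity (l %% p.-1 + p.-1 * x_ n); first by apply/H; rewrite modn_mod.
  by apply/esym/H; rewrite modn_mod.
congr #|pred_of_set _|; apply/setP => l; apply/imsetP/idP.
  case=> l' + ->; rewrite !inE => /Psi_irr_mod.
  by rewrite -tot1.
rewrite inE => Pl; have [x_ [_ _ H _]] := irregular_lift Pl (lift _ Pl).
have [_ /(_ erefl) [Px Ex]] := H n (l + p.-1 * x_ n).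
have lt : l + p.-1 * x_ n < totient (p ^ n.+1) by case/and5P: Px => _ _ _ _ /andP[].
exists (Ordinal lt); first by rewrite inE.
apply: val_inj => /=; rewrite [X in _ %% X]tot1 Ex modn_small //.
by rewrite -[p.-1]tot1 ltn_ord.
Qed.

End IrregularPairs.

(** * Growth of the indices and assembly of the sequences *)

Lemma irr_pairs_unbounded p (l : nat -> nat) :
  (forall n, (p, l n.+1) \in Psi_irr n.+1) ->
  (forall n, l n.+1 <= l n.+2) ->
  forall M, exists N, forall n, N <= n -> M <= l n.
Proof.
(* [N] bounds the numerators of all [Bhat i] with i < M. If l_(N+1) were below M, its nonzero
   numerator would be at most N, yet divisible by p^(N+1) > N. *)
move=> Pl l_mono M; pose N := \sum_(i < M) `|numq (Bhat i)|.
have leN m : m < M -> `|numq (Bhat m)| <= N.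
  by move=> mM; rewrite /N (bigD1 (Ordinal mM)) //= leq_addr.
suff MN : M <= l N.+1.
  exists N.+1 => n; elim: n => // n IHn; rewrite leq_eqVlt => /predU1P[<- //|].
  by case: n IHn => // n IHn /IHn /leq_trans; apply.
rewrite leqNgt; apply/negP => lM.
have /and5P[p_pr p_odd l_even l_gt1 /andP[_]] := Pl N; rewrite /dvdq /dvdz /=.
have q0 : 0 < `|numq (Bhat (l N.+1))|.
  by rewrite absz_gt0 numq_eq0 Bhat_neq0 // ltnW.
move=> /(dvdn_leq q0); apply/negP; rewrite -ltnNge.
apply: leq_ltn_trans (leN _ lM) _.
by apply: ltn_trans (ltnSn N) _; rewrite ltn_expl // prime_gt1.
Qed.

Theorem theorem3p1 (p : nat) :
  (forall l1 : nat, (p, l1) \in Psi_irr 1 -> Delta 1 p l1 <> 0 ->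
     [/\ (forall n : nat, 1 < n ->
            exists! ln : nat, (p, ln) \in Psi_irr n /\ related p 1 ln l1),
         (exists l : nat -> nat,
            [/\ irr_sequence p l1 l,
                (forall l' : nat -> nat, irr_sequence p l1 l' ->
                   forall n : nat, 1 <= n -> l' n = l n),
                (forall n : nat, 1 <= n -> l n <= l n.+1),
                (forall M : nat, exists N : nat,
                   forall n : nat, N <= n -> M <= l n)
              & (forall n : nat, 1 <= n -> Delta n p (l n) = Delta 1 p l1)])
       & (exists s : nat -> nat,
            irr_digit_sequence p l1 s /\
            (forall s' : nat -> nat, irr_digit_sequence p l1 s' ->
               forall n : nat, 1 <= n -> s' n = s n))])
  /\ (irregular p -> Delta_prime p = 1 ->
        forall n : nat, 1 <= n -> i_ n p = i_ 1 p).
Proof.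
split; last first.
  by move=> /and3P[p_pr p_odd i0] Dp [//|n] _; apply: card_irr.
move=> l1 Pl1 Dl1; have /and5P[/= p_pr p_odd l1_even l1_gt1 /andP[l1_lt _]] := Pl1.
have [x_ [x_lt x_mod x_P x_D]] := irregular_lift p_pr p_odd Pl1 Dl1.
have tot0 : totient (p ^ 0) = 1 by rewrite expn0.
have tot1 : totient (p ^ 1) = p.-1 by rewrite expn1 totient_prime.
have p_gt2 := odd_prime_gt2 p_odd p_pr.
have relE l : related p 1 l l1 <-> l = l1 %[mod p.-1].
  by rewrite /related tot1; split=> /eqP.
have x0 : x_ 0 = 0 by have := x_lt 0; case: (x_ 0).
have x_mono n : x_ n <= x_ n.+1 by rewrite x_mod leq_mod.
pose l n := l1 + p.-1 * x_ n.-1.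
have lP n : (p, l n.+1) \in Psi_irr n.+1 /\ l n.+1 = l1 %[mod p.-1] by apply/x_P.
have l_mono n : l n.+1 <= l n.+2 by rewrite leq_add2l leq_mul2l x_mono orbT.
split.
- case=> // n _; exists (l n.+1); split; first by have [? ?] := lP n; split=> //; apply/relE.
  by move=> ln [Pn /relE rn]; apply/esym/x_P.
- exists l; split.
  + split; first by rewrite /l x0 muln0 addn0.
      by case=> // n _; case: (lP n).
    by case=> // n _; apply/relE; case: (lP n).
  + move=> l' [l'1 l'P l'rel] [//|n] _; apply/x_P; split; first exact: l'P.
    by case: n => [|n]; [rewrite l'1 | apply/relE/l'rel].
  + by case.
  + by apply: (irr_pairs_unbounded (p := p)) => // n; case: (lP n).
  + by case=> // n _; apply: x_D.
(* For n = k + 2 this is the leading base-p digit of [x_ k.+1], with weight phi(p^(k+1)) = (p-1)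
   p^k; the entry l1 at n = 1 has weight phi(p^0) = 1. *)
pose s n := if n is m.+1 then if m is k.+1 then x_ m %/ p ^ k else l1 else 0.
have sumE n : padic_index p (digits s n.+1) = l n.+1.
  elim: n => [|n IHn]; rewrite padic_index_digits.
    by rewrite /padic_index big_ord0 /l x0 /= tot0 muln0 muln1 addn0.
  rewrite IHn /l /= totient_pS // [in RHS](divn_eq (x_ n.+1) (p ^ n)) -x_mod.
  by ring.
exists s; split.
  split=> //.
    case=> // n _; rewrite /Psihat_irr sumE; have [-> _] := lP n.
    have -> : head 0 (digits s n.+1) = l1 by rewrite -nth0 -(tnth_nth 0 _ ord0) tnth_mktuple.
    rewrite andbT l1_even l1_gt1 /=; apply/andP; split.
      rewrite all_map; apply/allP => v _ /=;  rewrite /s.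
      case: (val v) => [|k]; last by rewrite ltn_divLR ?expn_gt0 ?prime_gt0 // -expnS x_lt.
      by apply: leq_trans (leq_pred p); rewrite -tot1.
    (* Since l1 < p - 1, only l1 = p - 2 could exceed p - 3, and p - 2 is odd. *)
    move: l1_lt p_odd l1_even; rewrite tot1; case: (p) p_gt2 => [|[|[|q]]] //= _.
    by rewrite !subSS subn0 !ltnS leq_eqVlt => /predU1P[->|//] /=; case: odd.
  by case=> // n _; rewrite sumE; apply/relE; case: (lP n).
move=> s' [s'1 s'P s'rel].
have sumE' n : padic_index p (digits s' n.+1) = l n.+1.
  apply/x_P; split; first by have /and4P[] := s'P n.+1 isT.
  case: n => [|n]; last exact/relE/s'rel.
  by rewrite padic_index_digits /padic_index big_ord0 s'1 tot0 muln1.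
case=> // -[_|n _]; first by rewrite s'1.
(* Consecutive partial sums of [s] and [s'] agree, so their last summands do, and phi(p^(n+1))
   cancels. *)
have := sumE' n.+1; rewrite -sumE [LHS]padic_index_digits.
rewrite [RHS]padic_index_digits sumE sumE' => /addnI/eqP.
by rewrite eqn_pmul2r ?totient_gt0 ?expn_gt0 ?prime_gt0 // => /eqP.
Qed.
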